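(* Let $k$ be an integer and let $G$ be a finite graph with $\operatorname{mad}(G) < 2k$, and write $\Delta = \Delta(G)$. Then $G^2$ is $f(k,\Delta)$-degenerate, where \[ f(k,\Delta)=\max\left\{(2k-1)\Delta-k^2+k,\ (2k-2)\Delta+2k^3+k^2+1,\ (k-1)\Delta+k^4+2k^3+1\right\}. \]
   Context: For a graph $G$, $\Delta(G)$ denotes its maximum degree. The maximum average degree is $\operatorname{mad}(G)=\max\{2|E(H)|/|V(H)| : H \subseteq G\}$, the maximum over (nonempty) subgraphs $H$ of $G$. The square $G^2$ of $G$ is the graph on vertex set $V(G)$ in which two distinct vertices are adjacent if and only if their distance in $G$ is at most $2$. A graph is $d$-degenerate if every nonempty subgraph has a vertex of degree at most $d$ (equivalently, its vertices can be ordered so that each vertex has at most $d$ neighbors preceding it). *)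

(* Defs.v *)
From mathcomp Require Import all_boot all_order all_algebra.

Set Implicit Arguments.
Unset Strict Implicit.
Unset Printing Implicit Defensive.

Import Order.TTheory GRing.Theory Num.Theory.

(* Finite simple graphs; the empty graph is allowed. *)
Record sgraph := SGraph {
  vertex :> finType;
  edge : rel vertex;
  edge_sym : symmetric edge;
  edge_irr : irreflexive edge
}.

Section Graph.
Variable G : sgraph.

Definition degree (x : G) : nat := #|[set y | edge x y]|.

Definition max_degree : nat := \max_(x : G) degree x.

Definition edge_set : {set {set G}} :=
  [set [set p.1; p.2] | p : G * G & edge p.1 p.2].

(* Subgraphs, not necessarily induced, are pairs (V(H), E(H)). *)
Definition is_subgraph (H : {set G} * {set {set G}}) : bool :=
  (H.2 \subset edge_set) && [forall A in H.2, A \subset H.1].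

Definition sub_degree (H : {set G} * {set {set G}}) (x : G) : nat :=
  #|[set A in H.2 | x \in A]|.

(* The default 0 is harmless, the ratios being nonnegative; it is the value
   of mad on the empty graph, which has no nonempty subgraph. *)
Definition mad : rat :=
  (\big[Num.max/0]_(H : {set G} * {set {set G}} |
      is_subgraph H && (H.1 != set0))
    ((2 * #|H.2|)%:R / #|H.1|%:R))%R.

Definition walk (n : nat) (x y : G) : bool :=
  [exists p : n.-tuple G, path (@edge G) x p && (last x p == y)].

(* The length of a shortest walk, None standing for infinite distance: the
   range 0, ..., #|G| - 1 suffices as a shortest walk repeats no vertex. *)
Definition dist (x y : G) : option nat :=
  ohead [seq n <- iota 0 #|G| | walk n x y].

Definition square_edge (x y : G) : bool :=
  (x != y) && (if dist x y is Some n then n <= 2 else false).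

Lemma walk_sym n : symmetric (walk n).
Proof.
suff imp x y : walk n x y -> walk n y x by move=> x y; apply/idP/idP; exact: imp.
case/existsP=> p /andP[pth /eqP lst].
have sz : size (rev (belast x p)) == n by rewrite size_rev size_belast size_tuple.
apply/existsP; exists (Tuple sz) => /=; rewrite -lst; apply/andP; split.
  rewrite rev_path (@eq_path _ _ (@edge G)) // => u v; exact: edge_sym.
by case: (tval p) => [|a s] //=; rewrite rev_cons last_rcons.
Qed.

Lemma dist_sym x y : dist x y = dist y x.
Proof. by congr ohead; apply: eq_filter => n; exact: walk_sym. Qed.

Lemma square_edge_sym : symmetric square_edge.
Proof. by move=> x y; rewrite /square_edge eq_sym dist_sym. Qed.

Lemma square_edge_irr : irreflexive square_edge.
Proof. by move=> x; rewrite /square_edge eqxx. Qed.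

Definition square : sgraph := SGraph square_edge_sym square_edge_irr.

Definition degenerate (d : int) : Prop :=
  forall H : {set G} * {set {set G}}, is_subgraph H -> H.1 != set0 ->
    exists2 x : G, x \in H.1 & ((sub_degree H x)%:Z <= d)%R.

End Graph.

Definition degeneracy_bound (k D : int) : int :=
  Num.max ((2 * k - 1) * D - k ^+ 2 + k)%R
    (Num.max ((2 * k - 2) * D + 2 * k ^+ 3 + k ^+ 2 + 1)%R
             ((k - 1) * D + k ^+ 4 + 2 * k ^+ 3 + 1)%R).

(* Main.v *)
Require Import Defs.
From mathcomp Require Import all_boot all_order all_algebra.
From mathcomp Require Import zify ring lra.

Set Implicit Arguments.
Unset Strict Implicit.
Unset Printing Implicit Defensive.

Import Order.TTheory GRing.Theory Num.Theory.

(* Let [S] be a set of vertices such that each [x] in [S] has more than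
   [f(k, Delta)] square-neighbours in [S], and let [d(v)] be the number of
   neighbours of [v] in [S]. Discharging on the graph spanned by [S] and the
   outside vertices with [d(v) > k]: such an outside vertex, or a vertex of [S]
   with [d(v) >= 2k], takes [k/d(v)] from each of its [d(v)] edges to [S] and so
   gets exactly [k]. A remaining vertex [x] of [S] takes what is left of its
   edges (a half for an edge between two such vertices). A neighbour [v] of [x]
   adds at most [d(v)] square-neighbours to [x], or [d(v) - 1] if [v] is outside
   [S], and vertices of large [d] leave almost a full edge to [x]; hence if [x]
   got less than [k], it would have at most [f(k, Delta)] square-neighbours. So
   the edges number at least [k] times the vertices, against [mad G < 2k]. *)

(** * Averaging charges over an induced subgraph *)

Lemma sum_adjacent (G : sgraph) (V : {set G}) (F : G -> G -> rat) :
  (\sum_(p : G * G | [&& edge p.1 p.2, p.1 \in V & p.2 \in V]) F p.1 p.2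
   = \sum_(u in V) \sum_(v in V | edge u v) F u v)%R.
Proof.
rewrite pair_big_dep /=; apply: eq_bigl => -[u v] /=.
by rewrite [LHS]andbC andbA.
Qed.

(** The subgraph induced on [V] competes in the maximum defining [mad], and each of its edges comes
    from at most two ordered pairs. *)
Lemma adjacent_pairs_mad (G : sgraph) (V : {set G}) (q : rat) :
  V != set0 -> (mad G < q)%R ->
  (#|[set p : G * G | [&& edge p.1 p.2, p.1 \in V & p.2 \in V]]|%:R
     < q * #|V|%:R)%R.
Proof.
move=> V0 madq.
pose E := [set A in edge_set G | A \subset V].
have subE : is_subgraph (V, E).
  rewrite /is_subgraph /=; apply/andP; split.
    by apply/subsetP=> A; rewrite inE => /andP[].
  by apply/forall_inP=> A; rewrite inE => /andP[].
have V_gt0 : (0 < #|V|%:R :> rat)%R by rewrite ltr0n card_gt0.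
have ratio : ((2 * #|E|)%:R / #|V|%:R < q)%R.
  apply: le_lt_trans madq; rewrite /mad.
  have HP : is_subgraph (V, E) && ((V, E).1 != set0) by rewrite subE.
  exact: (le_bigmax_cond _ (fun H : {set G} * {set {set G}} =>
    ((2 * #|H.2|)%:R / #|H.1|%:R : rat)%R) HP).
rewrite ltr_pdivrMr // in ratio.
apply: le_lt_trans ratio; rewrite ler_nat.
set P := [set p | _].
pose f (p : G * G) := [set p.1; p.2].
rewrite -sum1_card (partition_big f (mem E)) /=; last first.
  move=> p; rewrite !inE => /and3P[e p1 p2].
  rewrite imset_f ?inE //=.
  by apply/subsetP=> z; rewrite !inE => /orP[] /eqP ->.
rewrite mulnC -sum_nat_const; apply: leq_sum => A.
rewrite inE => /andP[/imsetP[[a b] _ ->] _] /=.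
rewrite sum1dep_card.
apply: leq_trans (_ : #|[set (a, b); (b, a)]| <= 2); last first.
  by rewrite cards2; case: (_ != _).
apply: subset_leq_card; apply/subsetP=> -[c d]; rewrite !inE /f /=.
case/andP=> /and3P[ecd _ _] /eqP/setP eqs.
have cd : c != d by apply: contraTneq ecd => ->; rewrite edge_irr.
have := eqs c; have := eqs d; rewrite !inE !eqxx ?orbT /=.
move=> /esym/orP[]/eqP dE /esym/orP[]/eqP cE; move: cd; rewrite cE dE ?eqxx //.
by rewrite orbT.
Qed.

(* [phi u v] is the part of the edge [uv] charged to [u]. *)
Lemma undercharged_vertex (G : sgraph) (V : {set G}) (k : rat)
    (phi : G -> G -> rat) :
  V != set0 -> (mad G < 2 * k)%R ->
  (forall u v, edge u v -> u \in V -> v \in V -> (phi u v + phi v u <= 1)%R) ->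
  exists2 u, u \in V & (\sum_(v in V | edge u v) phi u v < k)%R.
Proof.
move=> V0 madk phi1; apply/exists_inP; apply: contraT.
rewrite negb_exists_in => /forall_inP charged.
have := adjacent_pairs_mad V0 madk.
rewrite -sum1_card natr_sum.
have swap : (\sum_(u in V) \sum_(v in V | edge u v) phi v u
           = \sum_(u in V) \sum_(v in V | edge u v) phi u v)%R.
  rewrite (exchange_big_dep (mem V)) //=; last by move=> u v _ /andP[].
  rewrite big_mkcond [RHS]big_mkcond; apply: eq_bigr => u _.
  case: ifP => // uV; apply: eq_bigl => v.
  by rewrite uV edge_sym.
suff: (2 * k * #|V|%:R <=
   \sum_(p in [set p : G * G | [&& edge p.1 p.2, p.1 \in V & p.2 \in V]]) 1)%R.
  by move=> /le_lt_trans h /h; rewrite ltxx.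
(* Summed over ordered pairs, [phi u v + phi v u] counts the total charge twice, hence at least
   [2 * k] per vertex, while each pair contributes at most 1. *)
apply: (@le_trans _ _ (\sum_(u in V) \sum_(v in V | edge u v)
                         (phi u v + phi v u))%R).
  under eq_bigr do rewrite big_split /=.
  rewrite big_split /= swap -mulr2n -[leRHS]mulr_natl -mulrA ler_pM2l //.
  rewrite mulr_natr -sumr_const; apply: ler_sum => u uV.
  by rewrite leNgt charged.
rewrite -(sum_adjacent V (fun u v => phi u v + phi v u)%R).
rewrite [leRHS](eq_bigl (fun p : G * G =>
  [&& edge p.1 p.2, p.1 \in V & p.2 \in V])); last by move=> p; rewrite inE.
by apply: ler_sum => p /and3P[*]; apply: phi1.
Qed.

(** * Square-neighbours and unions *)

Lemma square_edgeP (G : sgraph) (x y : G) :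
  square_edge x y -> edge x y \/ exists2 v, edge x v & edge v y.
Proof.
case/andP=> xy; rewrite /dist.
case E: [seq n <- _ | _] => [|n s] //= n2.
have: n \in [seq n <- iota 0 #|G| | walk n x y] by rewrite E inE eqxx.
rewrite mem_filter => /andP[/existsP[[p /= /eqP sz]] /andP[]].
case: n n2 sz {E} => [|[|[|]]] // _; case: p => [|a [|b [|]]] //= _.
- by move=> _ /eqP exy; rewrite exy eqxx in xy.
- by rewrite andbT => xa /eqP <-; left.
- by rewrite andbT => /andP[xa ab] /eqP <-; right; exists a.
Qed.

Lemma card_bigcup_leq (T I : finType) (P : pred I) (A : I -> {set T}) :
  #|\bigcup_(i | P i) A i| <= \sum_(i | P i) #|A i|.
Proof.
elim/big_rec2: _ => [|i n B _ le_n]; first by rewrite cards0.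
by apply: leq_trans (leq_card_setU _ _) _; rewrite leq_add2l.
Qed.

(** * Total weight around an undercharged vertex *)

Section WeightArithmetic.
Local Open Scope ring_scope.
Implicit Types K D M b c e v w : rat.

(** Here [b] and [c] count the neighbours of weight at least [M] and below [M], and [v] and [w] are
    their total weights. The resulting bound is affine in [b] with slope [D - M + e], so for
    [M <= D] the worst case is [b = K - 1]. *)
Lemma weight_le_few_big K D M b c e v w :
  M = K ^+ 3 + K ^+ 2 -> e * M = K -> e * K <= 1 -> K <= K ^+ 3 ->
  b * e <= e * K -> 0 <= (K - 1 - b) * (D - M) ->
  v <= b * D -> c * (K - 1) <= (D - b) * (K - 1) ->
  w <= c * (K - 1) + (M + 1) * (K - b * (1 - e)) ->
  v + w <= (2 * K - 2) * D + 2 * K ^+ 3 + K ^+ 2 + 1.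
Proof.
move=> ME eM eK K3 beK bDM h1 hc.
have -> : (M + 1) * (K - b * (1 - e)) = (M + 1) * (K - b) + b * K + b * e.
  by rewrite -[b * K](congr1 ( *%R b) eM); ring.
have -> : 2 * K ^+ 3 = 2 * (M - K ^+ 2) by rewrite ME; ring.
have {}K3 : K <= M - K ^+ 2 by lra.
by clear ME eM; lra.
Qed.

(** The zeros stand where [b] stood: no neighbour reaches weight [M]. *)
Lemma weight_le_no_big K D M c e v w :
  M = K ^+ 3 + K ^+ 2 -> K <= K ^+ 3 ->
  v <= 0 * D -> c * (K - 1) <= (D - 0) * (K - 1) ->
  w <= c * (K - 1) + (M + 1) * (K - 0 * (1 - e)) ->
  v + w <= (K - 1) * D + K ^+ 4 + 2 * K ^+ 3 + 1.
Proof.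
rewrite !mul0r !subr0 => -> K3 h1 hc.
have -> : (K ^+ 3 + K ^+ 2 + 1) * K = K ^+ 4 + K ^+ 3 + K by ring.
lra.
Qed.

(** Since [e * (K + 1) = 1 / K <= 1], already [K + 1] big vertices, each giving [1 - e], bring a
    charge of at least [K]. *)
Lemma gain_many_big K b e :
  e * K * (K + 1) = 1 -> 1 <= K -> 0 <= e -> e * K <= 1 -> K + 1 <= b ->
  K <= b * (1 - e).
Proof.
move=> eE K1 e0 eK bK.
have e1 : e <= 1 by apply: le_trans eK; rewrite ler_peMr.
have : (K + 1) * (1 - e) <= b * (1 - e) by rewrite ler_wpM2r //; lra.
have : 1 * (e * (K + 1)) <= K * (e * (K + 1)).
  by rewrite ler_wpM2r // mulr_ge0 //; lra.
have : K * (e * (K + 1)) = 1 by rewrite mulrA (mulrC K).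
lra.
Qed.

End WeightArithmetic.

(* [N] is the neighbourhood of an undercharged vertex. At most [k] of its
   vertices have weight at least [M]; the first bound comes from the case of
   exactly [k], where all the others have weight at most [k - 1], the second and
   third from the case of fewer than [k], according to whether [M <= D]. *)
Lemma weight_sum_bound (I : finType) (N : {set I}) (w : I -> nat)
    (g : I -> rat) (k D : nat) (M := k ^ 3 + k ^ 2)
    (K := k%:R%R : rat) (Dq := D%:R%R : rat) :
  0 < k -> #|N| <= D -> (forall v, v \in N -> w v <= D) ->
  (forall v, v \in N -> 0 <= g v)%R ->
  (forall v, v \in N -> (k <= w v)%N -> (K + 1)^-1 <= g v)%R ->
  (forall v, v \in N -> (M <= w v)%N -> 1 - K / M%:R <= g v)%R ->
  (forall v, v \in N -> (w v < M)%N ->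
     (w v)%:R <= K - 1 + (M%:R + 1) * g v)%R ->
  (\sum_(v in N) g v < K)%R ->
  [\/ (\sum_(v in N) w v)%N%:R <= (2 * K - 1) * Dq - K ^+ 2 + K,
      (\sum_(v in N) w v)%N%:R <= (2 * K - 2) * Dq + 2 * K ^+ 3 + K ^+ 2 + 1
    | (\sum_(v in N) w v)%N%:R <= (K - 1) * Dq + K ^+ 4 + 2 * K ^+ 3 + 1]%R.
Proof.
move=> k0 nD wD g0 g1 g2 g3.
pose b := #|[set v in N | M <= w v]|; pose c := #|[set v in N | ~~ (M <= w v)]|.
have bc : b + c = #|N|.
  rewrite -(cardsID [set v | M <= w v] N); congr (_ + _); apply: eq_card => v;
    by rewrite !inE // andbC.
rewrite (bigID (fun v => (M <= w v)%N) _ g) (bigID (fun v => M <= w v) _ w) /=.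
set X := (\sum_(i in N | (M <= w i)%N) g i)%R.
set Y := (\sum_(i in N | ~~ (M <= w i)%N) g i)%R.
set W1 := (\sum_(i in N | M <= w i) w i).
set W2 := (\sum_(i in N | ~~ (M <= w i)) w i).
have K1 : (1 <= K)%R by rewrite ler1n.
have ME : (M%:R = K ^+ 3 + K ^+ 2 :> rat)%R by rewrite natrD !natrX.
set e : rat := (K / M%:R)%R in g2 *.
have K2 : (1 <= K ^+ 2)%R by rewrite exprn_ege1.
have K3 : (K <= K ^+ 3)%R by rewrite exprS ler_peMr //; lra.
have M0 : (M%:R != 0 :> rat)%R by rewrite ME lt0r_neq0 //; lra.
(* [M] is chosen for this identity: [e * K] becomes [1 / (K + 1)], the lower bound in [g1]. *)
have eE : (e * K * (K + 1) = 1)%R.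
  by move: M0; rewrite /e ME => M0; field.
have eM : (e * M%:R = K)%R by rewrite /e divfK.
have e0 : (0 <= e)%R by rewrite divr_ge0 ?ler0n.
have Xb : (b%:R * (1 - e) <= X)%R.
  rewrite mulr_natl -sumr_const (eq_bigl (fun v => (v \in N) && (M <= w v)%N)).
    by apply: ler_sum => v /andP[/g2].
  by move=> v; rewrite inE.
have Y0 : (0 <= Y)%R by apply: sumr_ge0 => v /andP[vN _]; exact: g0.
have W1b : W1 <= b * D.
  rewrite -sum_nat_const (eq_bigl (fun v => (v \in N) && (M <= w v))).
    by apply: leq_sum => v /andP[/wD].
  by move=> v; rewrite inE.
have W2c : (W2%:R <= c%:R * (K - 1) + (M%:R + 1) * Y)%R.
  rewrite mulr_natl -sumr_const.
  rewrite (eq_bigl (fun v => (v \in N) && ~~ (M <= w v)%N)).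
    rewrite /Y mulr_sumr -big_split natr_sum /=.
    by apply: ler_sum => v /andP[vN]; rewrite -ltnNge; apply: g3.
  by move=> v; rewrite inE.
have eK : (e * K <= 1)%R by nra.
move=> XY.
have Dbc : (b%:R + c%:R <= Dq :> rat)%R by rewrite -natrD bc ler_nat.
have W1q : (W1%:R <= b%:R * Dq :> rat)%R by rewrite -natrM ler_nat.
have cD : (c%:R * (K - 1) <= (Dq - b%:R) * (K - 1))%R.
  by rewrite ler_wpM2r //; lra.
have [bk|kb|bk] := ltngtP b k.
- have bK : (b%:R + 1 <= K :> rat)%R by rewrite natr1 ler_nat.
  have YK : (Y <= K - b%:R * (1 - e))%R by lra.
  have W2K : (W2%:R <= c%:R * (K - 1) + (M%:R + 1) * (K - b%:R * (1 - e)))%R.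
    by apply: le_trans W2c _; rewrite lerD2l ler_wpM2l // addr_ge0.
  have [MD|DM] := leqP M D.
    have MDq : (M%:R <= Dq)%R by rewrite ler_nat.
    apply: Or32.
    have bDM : (0 <= (K - 1 - b%:R) * (Dq - M%:R))%R.
      by rewrite mulr_ge0 //; lra.
    have beK : (b%:R * e <= e * K)%R by rewrite mulrC ler_wpM2l //; lra.
    rewrite natrD; apply: (weight_le_few_big ME eM eK K3 beK bDM W1q cD W2K).
  apply: Or33.
  have b0 : b = 0.
    apply/eqP; rewrite cards_eq0; apply/eqP/setP=> v; rewrite !inE.
    apply/negbTE/negP=> /andP[vN Mv].
    by have := leq_ltn_trans (leq_trans Mv (wD _ vN)) DM; rewrite ltnn.
  rewrite b0 /= in W2K W1q cD.
  rewrite natrD; apply: (weight_le_no_big ME K3 W1q cD W2K).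
- have bK : (K + 1 <= b%:R :> rat)%R by rewrite natr1 ler_nat.
  have := gain_many_big eE K1 e0 eK bK; lra.
- have bK : (b%:R = K :> rat)%R by rewrite bk.
  apply: Or31.
  have W2K : (W2%:R <= c%:R * (K - 1))%R.
    rewrite mulr_natl -sumr_const.
    rewrite (eq_bigl (fun v => (v \in N) && ~~ (M <= w v)%N)).
      rewrite natr_sum; apply: ler_sum => v /andP[vN Mv].
      have [kv|vk] := leqP k (w v); last first.
        by rewrite lerBrDr natr1 ler_nat.
      (* The [k] big vertices leave [Y < K * e = 1 / (K + 1)], too little for even one further
         vertex of weight at least [k]. *)
      have : (g v <= Y)%R.
        rewrite /Y (bigD1 v) ?vN //= lerDl; apply: sumr_ge0 => u.
        by case/andP=> /andP[/g0].
      have := g1 _ vN kv.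
      have -> : ((K + 1)^-1 = e * K)%R.
        apply: (mulIf (x := K + 1)%R); first by apply: lt0r_neq0; lra.
        rewrite eE mulVf //; apply: lt0r_neq0; lra.
      rewrite bK in Xb; lra.
    by move=> v; rewrite inE.
  by rewrite bK in W1q cD; rewrite natrD; clear -W1q cD W2K; lra.
Qed.

(** * Weights dominate the degree in the square *)

Section Weights.
Variables (G : sgraph) (S : {set G}).

Definition inner_degree (v : G) : nat := #|[set y in S | edge v y]|.

(* The number of vertices of [S] other than [x] that a neighbour [v] of
   [x \in S] puts within distance 2 of [x]. *)
Definition weight (v : G) : nat := inner_degree v - (v \notin S).

(** Each neighbour [v] of [x] accounts for itself if it lies in [S], and for its neighbours in [S]
    except [x]. Removing [x] costs 1, which [v] restores exactly when it is in [S]. *)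
Lemma sub_degree_square (E : {set {set G}}) (x : G) :
  is_subgraph (G := square G) (S, E) -> x \in S ->
  sub_degree (G := square G) (S, E) x
    <= \sum_(v in [set v | edge x v]) weight v.
Proof.
case/andP=> /subsetP /= subE /forall_inP /= subS xS.
pose Y := [set y in S | square_edge x y].
apply: (@leq_trans #|Y|).
  apply: leq_trans (leq_imset_card (fun y => [set x; y]) (mem Y)).
  apply: subset_leq_card; apply/subsetP=> A; rewrite inE /= => /andP[AE].
  have /imsetP[[a b]] := subE _ AE; rewrite inE /= => ab eA.
  have /subsetP := subS _ AE; rewrite eA => AS.
  have [aS bS] : a \in S /\ b \in S by rewrite !AS // !inE eqxx ?orbT.
  rewrite !inE => /orP[]/eqP xE; apply/imsetP.
    by exists b; rewrite ?inE ?bS xE.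
  by exists a; rewrite ?inE ?aS xE 1?setUC // square_edge_sym.
have cover : Y \subset \bigcup_(v in [set v | edge x v])
    ([set y in [set v] | y \in S] :|: ([set y in S | edge v y] :\ x)).
  apply/subsetP=> y; rewrite inE => /andP[yS xy]; apply/bigcupP.
  have neq : x != y by case/andP: xy.
  case: (square_edgeP xy) => [exy|[v xv vy]].
    by exists y; rewrite !inE ?eqxx ?yS.
  by exists v; rewrite !inE // yS vy (eq_sym y x) neq !orbT.
apply: leq_trans (subset_leq_card cover) _.
apply: leq_trans (card_bigcup_leq _ _) _ => /=.
apply: leq_sum => v; rewrite inE => xv.
apply: leq_trans (leq_card_setU _ _) _.
have := cardsD1 x [set y in S | edge v y].
rewrite inE xS edge_sym xv /= /weight /inner_degree => ->.
have [vS|vS] := boolP (v \in S).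
  rewrite subn0 leq_add2r -(cards1 v); apply: subset_leq_card.
  by apply/subsetP=> z; rewrite !inE => /andP[].
rewrite add1n subn1 -[leqRHS]add0n leq_add2r leqn0 cards_eq0.
apply/eqP/setP=> z; rewrite !inE; apply/negbTE/negP=> /andP[/eqP ->].
exact/negP.
Qed.

Lemma weight_le_max_degree (v : G) : weight v <= max_degree G.
Proof.
apply: leq_trans (leq_subr _ _) _.
apply: leq_trans (leq_bigmax (F := @degree G) v); apply: subset_leq_card.
by apply/subsetP=> y; rewrite !inE => /andP[].
Qed.

(** * The discharging rule and its gains *)

Variable k : nat.
Hypothesis k_gt0 : 0 < k.

(** Inside [S] the threshold [2 * k] keeps tolls at most a half, so that both ends of an edge may
    take one. *)
Definition active (v : G) : bool :=
  if v \in S then 2 * k <= inner_degree v else k < inner_degree v.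

(** The value 0 belongs to vertices outside the discharging graph, so that gains can be summed over
    a whole neighbourhood. *)
Definition gain (v : G) : rat :=
  (if active v then 1 - k%:R / (inner_degree v)%:R
   else if v \in S then 2^-1 else 0)%R.

Definition charge (u v : G) : rat :=
  (if active u then if v \in S then k%:R / (inner_degree u)%:R else 0
   else gain v)%R.

Lemma active_degree (v : G) : active v -> k < inner_degree v.
Proof. by rewrite /active; case: ifP => // _; lia. Qed.

Lemma toll_le (v : G) m : active v -> 0 < m <= inner_degree v ->
  (k%:R / (inner_degree v)%:R <= k%:R / m%:R :> rat)%R.
Proof.
move=> av /andP[m0 mv]; rewrite ler_wpM2l ?ler0n // lef_pV2 ?ler_nat //.
  by rewrite posrE ltr0n; apply: leq_trans mv.
by rewrite posrE ltr0n.
Qed.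

Lemma toll_ge0 (v : G) : (0 <= k%:R / (inner_degree v)%:R :> rat)%R.
Proof. by rewrite divr_ge0 ?ler0n. Qed.

Lemma toll_le1 (v : G) : active v ->
  (k%:R / (inner_degree v)%:R <= 1 :> rat)%R.
Proof.
move=> av; rewrite -[leRHS](@divff rat k%:R%R) ?pnatr_eq0 -?lt0n //.
by apply: toll_le => //; rewrite k_gt0 ltnW // active_degree.
Qed.

Lemma toll_le_half (v : G) : active v -> v \in S ->
  (k%:R / (inner_degree v)%:R <= 2^-1 :> rat)%R.
Proof.
move=> av vS; have -> : (2^-1 = k%:R / (2 * k)%:R :> rat)%R.
  by rewrite natrM; field; rewrite pnatr_eq0 -lt0n.
by apply: toll_le => //; move: av; rewrite /active vS; lia.
Qed.

(** One active end takes its toll and the inactive end the complement; two inactive ends lie in [S]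
    and take a half each. Of two active ends, each takes a toll only if the other is in [S]. *)
Lemma charge_edge (u v : G) : (u \in S) || active u -> (v \in S) || active v ->
  (charge u v + charge v u <= 1)%R.
Proof.
rewrite /charge /gain.
have /implyP := @toll_le1 u; have /implyP := @toll_le1 v.
have half w : (active w && (w \in S)) ==>
    (k%:R / (inner_degree w)%:R <= 2^-1 :> rat)%R.
  by apply/implyP=> /andP[]; exact: toll_le_half.
have := half u; have := half v; have := toll_ge0 u; have := toll_ge0 v.
case: (active u); case: (active v); case: (u \in S); case: (v \in S) => //= *;
  lra.
Qed.

Lemma gain_ge0 (v : G) : (0 <= gain v)%R.
Proof.
rewrite /gain; case: ifP => [av|_]; last by case: ifP.
by rewrite subr_ge0 toll_le1.
Qed.

Lemma charge_active (u : G) (V : {set G}) : S \subset V -> active u ->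
  (\sum_(v in V | edge u v) charge u v = k%:R)%R.
Proof.
move=> /subsetP SV au; rewrite /charge au -big_mkcondr /=.
rewrite (eq_bigl (fun v => v \in [set y in S | edge u y])) => [|v].
  rewrite sumr_const -[LHS]mulr_natr divfK // pnatr_eq0 -lt0n.
  exact: leq_ltn_trans (active_degree au).
by rewrite inE; case vS: (v \in S); rewrite ?andbF //= (SV _ vS) /= andbT.
Qed.

(** An active vertex has inner degree at least [k + 1], and an inactive one in [S] gives a half; an
    inactive one outside [S] has weight below [k]. *)
Lemma gain_medium (v : G) : k <= weight v -> ((k%:R + 1)^-1 <= gain v)%R.
Proof.
rewrite /gain => kw.
have [av|nav] := boolP (active v).
  have := toll_le av (m := k.+1); rewrite active_degree // => /(_ isT).
  have -> : (k%:R / k.+1%:R = 1 - (k%:R + 1)^-1 :> rat)%R.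
    by rewrite -natr1; field; rewrite natr1 pnatr_eq0.
  lra.
case: ifP => vS.
  rewrite lef_pV2 ?posrE // ?natr1 ?ltr0n // ler_nat; lia.
by move: nav kw; rewrite /active /weight vS /=; lia.
Qed.

Lemma gain_big (v : G) : k ^ 3 + k ^ 2 <= weight v ->
  (1 - k%:R / (k ^ 3 + k ^ 2)%:R <= gain v)%R.
Proof.
move=> Mw.
have M2k : 2 * k <= k ^ 3 + k ^ 2 by nia.
have Md : k ^ 3 + k ^ 2 <= inner_degree v.
  exact: leq_trans Mw (leq_subr _ _).
have av : active v.
  by rewrite /active; case: ifP => vS; move: Mw; rewrite /weight vS /=; lia.
rewrite /gain av lerD2l lerN2; apply: toll_le => //; lia.
Qed.

Lemma weight_le_gain (v : G) : weight v < k ^ 3 + k ^ 2 ->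
  ((weight v)%:R <= k%:R - 1 + ((k ^ 3 + k ^ 2)%:R + 1) * gain v)%R.
Proof.
have M2k : 2 * k <= k ^ 3 + k ^ 2 by nia.
set M := k ^ 3 + k ^ 2 in M2k *; clearbody M => wM; rewrite /gain.
have [av|nav] := boolP (active v); last first.
  case: ifP => vS.
    move: nav wM; rewrite /active /weight vS subn0 -ltnNge => d2 _.
    have : ((inner_degree v).+1%:R <= (2 * k)%:R :> rat)%R by rewrite ler_nat.
    have : ((2 * k)%:R <= M%:R :> rat)%R by rewrite ler_nat.
    by rewrite -natr1 natrM; lra.
  rewrite mulr0 addr0 lerBrDr natr1 ler_nat.
  by move: nav; rewrite /active /weight vS /=; lia.
have kd := active_degree av.
have d0 : (0 < (inner_degree v)%:R :> rat)%R by rewrite ltr0n; lia.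
have kdq : (k%:R + 1 <= (inner_degree v)%:R :> rat)%R by rewrite natr1 ler_nat.
rewrite -subr_ge0 -(pmulr_lge0 _ d0).
set d := (inner_degree v)%:R%R in d0 kdq *.
(* With denominators cleared, the difference is [(M - 1 - d) * (d - k) + (d - 2 * k)] in [S], and
   [(M - d) * (d - k) + (d - k)] outside. *)
have -> : ((k%:R - 1 + (M%:R + 1) * (1 - k%:R / d) - (weight v)%:R) * d
   = (M%:R + 1) * (d - k%:R) - ((weight v)%:R - k%:R + 1) * d)%R.
  by field; rewrite lt0r_neq0.
case vS: (v \in S).
  have wd : ((weight v)%:R = d)%R by rewrite /weight vS subn0.
  have d2k : (2 * k%:R <= d)%R.
    by rewrite -natrM ler_nat; move: av; rewrite /active vS.
  have dM : (d + 1 <= M%:R)%R.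
    by rewrite natr1 ler_nat; move: wM; rewrite /weight vS subn0.
  rewrite wd.
  have : (0 <= (M%:R - 1 - d) * (d - k%:R))%R by rewrite mulr_ge0 //; lra.
  lra.
have wd : ((weight v)%:R = d - 1)%R.
  by rewrite /weight vS natrB //; lia.
have dM : (d <= M%:R)%R.
  by rewrite ler_nat; move: wM; rewrite /weight vS /=; lia.
rewrite wd; have : (0 <= (M%:R - d) * (d - k%:R))%R by rewrite mulr_ge0 //; lra.
lra.
Qed.

Lemma light_vertex : S != set0 -> (mad G < 2 * k%:R)%R ->
  exists2 u, u \in S & (\sum_(v in [set v | edge u v]) gain v < k%:R)%R.
Proof.
move=> S0 madk; pose V := [set v | (v \in S) || active v].
have SV : S \subset V by apply/subsetP=> v; rewrite inE => ->.
have V0 : V != set0 by apply: contraNneq S0 => V0; rewrite -subset0 -V0.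
have [u v euv uV vV|u uV light] := undercharged_vertex (phi := charge) V0 madk.
  by rewrite !inE in uV vV; apply: charge_edge.
(* Active vertices receive exactly [k], so an undercharged one is inactive and hence in [S]. *)
have nau : ~~ active u.
  by apply: contraTN light => au; rewrite charge_active // ltxx.
exists u; first by move: uV; rewrite inE (negbTE nau) orbF.
rewrite (le_lt_trans _ light) // /charge (negbTE nau) le_eqVlt; apply/orP; left.
apply/eqP; rewrite big_mkcond [RHS]big_mkcond; apply: eq_bigr => v _.
rewrite !inE andbC; case: (edge u v) => //=; case: ifP => // /norP[vS nav].
by rewrite /gain (negbTE nav) (negbTE vS).
Qed.

End Weights.

(** * Degeneracy of the square *)

Theorem theorem3 (k : int) (G : sgraph) :
  (mad G < (2 * k)%:~R)%R ->
  degenerate (square G) (degeneracy_bound k (max_degree G)%:Z).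
Proof.
move=> madk [S E] subE /= S0.
(* The default 0 makes [mad G] nonnegative, which forces the integer [k] to be positive. *)
have : (0 < (2 * k)%:~R :> rat)%R.
  by apply: le_lt_trans madk; apply: bigmax_ge_id.
case: k madk => [k|k]; last by rewrite ltr0z NegzE; lia.
rewrite ltr0z => madk k_gt0; have {}k_gt0 : 0 < k by lia.
have {}madk : (mad G < 2 * k%:R)%R by move: madk; rewrite intrM.
have [u uS light] := light_vertex (G := G) k_gt0 S0 madk.
exists u => //.
have := weight_sum_bound k_gt0 (leq_bigmax (F := @degree G) u)
  (fun v _ => weight_le_max_degree (G := G) S v)
  (fun v _ => gain_ge0 (G := G) S k_gt0 v)
  (fun v _ => @gain_medium G S k k_gt0 v) (fun v _ => @gain_big G S k k_gt0 v)
  (fun v _ => @weight_le_gain G S k k_gt0 v) light.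
have le_w : ((sub_degree (G := square G) (S, E) u)%:R
   <= (\sum_(v in [set v : G | edge u v]) weight (G := G) S v)%N%:R :> rat)%R.
  by rewrite ler_nat sub_degree_square.
rewrite /degeneracy_bound !le_max -!(ler_int rat).
rewrite !(intrD, intrM, rmorphXn, rmorphN, rmorphB) /=.
by case=> /(le_trans le_w) ->; rewrite ?orbT.
Qed.
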